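(* Let $n\ge 1$ and let $\mathcal{A}=(\mathbb{C}[(\mathbb{Z}_2)^n],f)$ and $\mathcal{A}'=(\mathbb{C}[(\mathbb{Z}_2)^n],f')$ be two complex twisted group algebras over $(\mathbb{Z}_2)^n$. If some function $\alpha:(\mathbb{Z}_2)^n\to\mathbb{Z}_2$ is a generating function of both $\mathcal{A}$ and $\mathcal{A}'$, then $\mathcal{A}$ and $\mathcal{A}'$ are isomorphic as $(\mathbb{Z}_2)^n$-graded algebras.
   Context: Let $\mathbb{K}=\mathbb{R}$ or $\mathbb{C}$ and let $f:(\mathbb{Z}_2)^n\times(\mathbb{Z}_2)^n\to\mathbb{Z}_2$ be a function with $f(0,\cdot)=f(\cdot,0)=0$ (not necessarily a 2-cocycle). The twisted group algebra $(\mathbb{K}[(\mathbb{Z}_2)^n],f)$ is the unital $\mathbb{K}$-algebra with basis $u_x$, $x\in(\mathbb{Z}_2)^n$, and product $u_x\cdot u_y=(-1)^{f(x,y)}u_{x+y}$, graded by $\deg u_x=x$. It determines functions $\beta$ and $\phi$ with values in $\mathbb{Z}_2$ by $u_x\cdot u_y=(-1)^{\beta(x,y)}u_y\cdot u_x$ and $u_x\cdot(u_y\cdot u_z)=(-1)^{\phi(x,y,z)}(u_x\cdot u_y)\cdot u_z$; that is, $\beta(x,y)=f(x,y)+f(y,x)$ and $\phi(x,y,z)=f(y,z)+f(x+y,z)+f(x,y+z)+f(x,y)$. A function $\alpha:(\mathbb{Z}_2)^n\to\mathbb{Z}_2$ is a generating function of the algebra if for all $x,y,z$: $\beta(x,y)=\alpha(x+y)+\alpha(x)+\alpha(y)$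 and $\phi(x,y,z)=\alpha(x+y+z)+\alpha(x+y)+\alpha(x+z)+\alpha(y+z)+\alpha(x)+\alpha(y)+\alpha(z)$. *)

(* Defs.v *)
From HB Require Import structures.
From mathcomp Require Import all_boot all_order all_algebra.

Set Implicit Arguments.
Unset Strict Implicit.
Unset Printing Implicit Defensive.

Import GRing.Theory.
Local Open Scope ring_scope.

(* The group (Z_2)^n. *)
Notation Z2pow n := 'rV['F_2]_n.

Section TwistedGroupAlgebra.
Variables (K : fieldType) (n : nat).
Implicit Types (f : Z2pow n -> Z2pow n -> 'F_2) (x y z : Z2pow n).

(* An element is the family of its coordinates on the basis (u_x).  The type
   mentions [f] only so that each twist has its own product; as the algebra is
   not associative in general, it cannot be an instance of a library ring. *)
Definition twalg f : Type := {ffun Z2pow n -> K^o}.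

HB.instance Definition _ f := Vector.copy (twalg f) {ffun Z2pow n -> K^o}.

Definition tw_coord f (a : twalg f) x : K := (a : {ffun Z2pow n -> K^o}) x.

Definition tw_basis f x : twalg f := [ffun y => (y == x)%:R].

Definition sign2 (c : 'F_2) : K := (-1) ^+ (val c).

Definition tw_mul f (a b : twalg f) : twalg f :=
  \sum_x \sum_y
    (tw_coord a x * tw_coord b y * sign2 (f x y)) *: tw_basis f (x + y).

Definition tw_one f : twalg f := tw_basis f 0.

Definition tw_component f x : {vspace twalg f} := <[tw_basis f x]>%VS.

(* Graded means degree-preserving: the component of degree x of the source
   corresponds to the component of the same degree x of the target. *)
Definition graded_isomorphic f f' : Prop :=
  exists F : {linear twalg f -> twalg f'},
    [/\ bijective F,
        F (tw_one f) = tw_one f',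
        forall a b, F (tw_mul a b) = tw_mul (F a) (F b)
      & forall x a, (F a \in tw_component f' x) = (a \in tw_component f x)].

End TwistedGroupAlgebra.

Section GeneratingFunction.
Variable n : nat.
Implicit Types (f : Z2pow n -> Z2pow n -> 'F_2) (x y z : Z2pow n).

Definition normalized f : Prop := forall x, f 0 x = 0 /\ f x 0 = 0.

Definition tw_beta f x y : 'F_2 := f x y + f y x.

Definition tw_phi f x y z : 'F_2 :=
  f y z + f (x + y) z + f x (y + z) + f x y.

Definition generating_function f (alpha : Z2pow n -> 'F_2) : Prop :=
  (forall x y, tw_beta f x y = alpha (x + y) + alpha x + alpha y) /\
  (forall x y z, tw_phi f x y z =
     alpha (x + y + z) + alpha (x + y) + alpha (x + z) + alpha (y + z)
     + alpha x + alpha y + alpha z).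

End GeneratingFunction.

Section Facts.
Variables (K : fieldType) (n : nat) (f : Z2pow n -> Z2pow n -> 'F_2).
Local Notation u := (tw_basis K f).

Lemma sign2D (c d : 'F_2) : sign2 K (c + d) = sign2 K c * sign2 K d.
Proof.
by case: c d => [[|[|//]] ?] [[|[|//]] ?];
  rewrite /sign2 /= ?expr0 ?expr1 ?mulr1 ?mul1r ?mulrNN ?mulr1.
Qed.

Lemma addr22 (c : 'F_2) : c + c = 0.
Proof. by case: c => [[|[|//]] ?]; apply/val_inj. Qed.

Lemma tw_coord_basis x y : tw_coord (u x) y = (y == x)%:R.
Proof. by rewrite /tw_coord ffunE. Qed.

Lemma tw_coordZ (c : K) (a : twalg K f) x :
  tw_coord (c *: a) x = c * tw_coord a x.
Proof. by rewrite /tw_coord ffunE. Qed.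

Lemma tw_expand (a : twalg K f) : a = \sum_x tw_coord a x *: u x.
Proof.
apply/ffunP => y; rewrite sum_ffunE (bigD1 y) //= big1 => [|x /negPf xy].
  by rewrite !ffunE eqxx addr0 /= /GRing.scale /= mulr1.
by rewrite !ffunE eq_sym xy /GRing.scale /= mulr0.
Qed.

Lemma tw_mul_scale_basis (c d : K) x y :
  tw_mul (c *: u x) (d *: u y) = (c * d * sign2 K (f x y)) *: u (x + y).
Proof.
rewrite /tw_mul (bigD1 x) //= [X in _ + X]big1 => [|i /negPf ix]; last first.
  by apply: big1 => j _; rewrite tw_coordZ tw_coord_basis ix mulr0 !mul0r scale0r.
rewrite addr0 (bigD1 y) //= big1 => [|j /negPf jy]; last first.
  by rewrite !tw_coordZ !tw_coord_basis jy !mulr0 mul0r scale0r.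
by rewrite addr0 !tw_coordZ !tw_coord_basis !eqxx !mulr1.
Qed.

Lemma tw_mul_basis x y : tw_mul (u x) (u y) = sign2 K (f x y) *: u (x + y).
Proof. by have := tw_mul_scale_basis 1 1 x y; rewrite !scale1r !mul1r. Qed.

Lemma tw_mul_betaE x y :
  tw_mul (u x) (u y) = sign2 K (tw_beta f x y) *: tw_mul (u y) (u x).
Proof.
by rewrite !tw_mul_basis scalerA -sign2D -addrA addr22 addr0 (addrC y).
Qed.

Lemma tw_mul_phiE x y z :
  tw_mul (u x) (tw_mul (u y) (u z)) =
  sign2 K (tw_phi f x y z) *: tw_mul (tw_mul (u x) (u y)) (u z).
Proof.
rewrite !tw_mul_basis -[u x]scale1r -[u z]scale1r !tw_mul_scale_basis.
rewrite !scalerA !mul1r !mulr1 -!sign2D addrA; congr (sign2 K _ *: _).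
rewrite /tw_phi -[RHS]addrA (addrA (f x y)) addr22 add0r.
by rewrite [RHS]addrAC -(addrA (f y z) _ (f (x + y) z)) addr22 addr0.
Qed.

Hypothesis f0 : normalized f.

Lemma tw_mul1l (a : twalg K f) : tw_mul (tw_one K f) a = a.
Proof.
rewrite /tw_mul (bigD1 0) //= [X in _ + X]big1 => [|i /negPf ix]; last first.
  by apply: big1 => j _; rewrite tw_coord_basis ix !mul0r scale0r.
rewrite addr0 [RHS]tw_expand; apply: eq_bigr => y _.
by rewrite tw_coord_basis eqxx (f0 y).1 /sign2 mulr1 mul1r add0r.
Qed.

Lemma tw_mul1r (a : twalg K f) : tw_mul a (tw_one K f) = a.
Proof.
rewrite [RHS]tw_expand; apply: eq_bigr => x _.
rewrite (bigD1 0) //= big1 => [|j /negPf jx]; last first.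
  by rewrite tw_coord_basis jx mulr0 mul0r scale0r.
by rewrite tw_coord_basis eqxx (f0 x).2 /sign2 !mulr1 !addr0.
Qed.

End Facts.

(* Main.v *)
(** If [f] and [f'] share a generating function, then [g = f + f'] is a symmetric
    2-cocycle on the elementary abelian group (Z_2)^n.  Over a field containing
    a square root of -1 the sign cocycle (-1)^g is the coboundary of a nowhere
    vanishing function [c]: a trivialization on a subspace [V] extends to
    [V + <e>] once [c e] is a square root of (-1)^g(e,e).  The rescaling
    u_x |-> c(x) u'_x is then the graded isomorphism. *)
Require Import Defs.
From HB Require Import structures.
From mathcomp Require Import all_boot all_order all_algebra.
From mathcomp Require Import ring.
From mathcomp Require Import reals.
From mathcomp Require Import complex.
Set Implicit Arguments.
Unset Strict Implicit.
Unset Printing Implicit Defensive.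

Import GRing.Theory.
Local Open Scope ring_scope.

Lemma Z2pow_addxx n (x : Z2pow n) : x + x = 0.
Proof. by apply/rowP => i; rewrite !mxE addr22. Qed.

Lemma sign2_neq0 (K : fieldType) (c : 'F_2) : sign2 K c != 0.
Proof. by rewrite /sign2 signr_eq0. Qed.

Lemma F2_scale_cases n (k : 'F_2) (e : Z2pow n) : k *: e = 0 \/ k *: e = e.
Proof.
case: k => [[|[|//]] k2]; [left | right].
  by rewrite (_ : Ordinal k2 = 0) ?scale0r //; apply/val_inj.
by rewrite (_ : Ordinal k2 = 1) ?scale1r //; apply/val_inj.
Qed.

Section SignCocycle.
Variables (K : fieldType) (j : K) (n : nat) (g : Z2pow n -> Z2pow n -> 'F_2).
Hypothesis j2 : j ^+ 2 = -1.
Hypothesis g0 : normalized g.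
Hypothesis gC : forall x y, g x y = g y x.
Hypothesis gA : forall x y z, tw_phi g x y z = 0.

Lemma cocycleE x y z : g x y + g y z = g x (y + z) + g (x + y) z.
Proof.
have := gA x y z; rewrite /tw_phi.
move: (g x y) (g (x + y) z) (g y z) (g x (y + z)).
by do 4! [case=> [[|[|//]] ?]] => /(congr1 val) //= _; apply/val_inj.
Qed.

(** Combine the cocycle identities at [(h, e, k + e)] and [(k, e, e)]: since [e + e = 0], the second
    one computes [g (k + e) e], which by symmetry is the term [g e (k + e)] of the first. *)
Lemma cocycle_shift h k e :
  g (h + e) (k + e) = g h k + g e e + g h e + g k e.
Proof.
have := cocycleE h e (k + e); have := cocycleE k e e.
rewrite (gC e (k + e)) (addrCA e k e) Z2pow_addxx addr0 (g0 k).2.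
move: (g h k) (g e e) (g h e) (g k e) (g (k + e) e) (g (h + e) (k + e)).
by do 6! [case=> [[|[|//]] ?]] => /(congr1 val) //= _ /(congr1 val) //= _;
  apply/val_inj.
Qed.

(** The root is 1 or [j]; this is where the square root of -1 enters. *)
Lemma sign2_sqrt (a : 'F_2) : exists2 d : K, d != 0 & d * d = sign2 K a.
Proof.
case: a => [[|[|//]] a2]; first by exists 1; rewrite ?oner_eq0 // mulr1.
exists j; last by rewrite -expr2 j2.
by rewrite -sqrf_eq0 j2 oppr_eq0 oner_eq0.
Qed.

(** Only the product rule is restricted to [V]; [c] is total and nonzero everywhere, so values
    outside [V] stay harmless when [V] grows. *)
Definition trivializes (c : Z2pow n -> K) (V : {vspace Z2pow n}) :=
  (forall x, c x != 0) /\
  {in V &, forall x y, c x * c y = sign2 K (g x y) * c (x + y)}.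

Lemma trivializes_extend c (V : {vspace Z2pow n}) e :
  trivializes c V -> exists c', trivializes c' (<[e]> + V)%VS.
Proof.
move=> [c0 cM]; have [eV|eV] := boolP (e \in V).
  by exists c; rewrite (addv_idPr _).
have [d d0 dd] := sign2_sqrt (g e e).
(* With [d] as value at [e], the product rule for [h] and [e] forces the value at [h + e], signs
   being their own inverses. Here [h] is recovered as [x + e]. *)
pose c' x := if x \in V then c x else c (x + e) * d * sign2 K (g (x + e) e).
have addee x : x + e + e = x by rewrite -addrA Z2pow_addxx addr0.
have c'e h : h \in V -> c' (h + e) = c h * d * sign2 K (g h e).
  by move=> hV; rewrite /c' rpredDl // (negPf eV) addee.
have c'V h : h \in V -> c' h = c h by rewrite /c' => ->.
have VeP x : x \in (<[e]> + V)%VS -> x \in V \/ exists2 h, h \in V & x = h + e.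
  case/memv_addP => _ /vlineP[k ->] [h hV ->].
  case: (F2_scale_cases k e) => ->; first by left; rewrite add0r.
  by right; exists h => //; rewrite addrC.
(* One factor in [V], one in the coset of [e]: the rule for [c] on [V] and the cocycle identity at
   [(x, h, e)] suffice. *)
have mixed x h : x \in V -> h \in V ->
    c' x * c' (h + e) = sign2 K (g x (h + e)) * c' (x + (h + e)).
  move=> xV hV; rewrite addrA !c'e ?memvD // c'V //.
  rewrite !mulrA cM //.
  have := congr1 (sign2 K) (cocycleE x h e); rewrite !sign2D => E.
  ring: E.
exists c'; split=> [x|x y /VeP[xV|[h hV ->]] /VeP[yV|[k kV ->]]].
- by rewrite /c'; case: ifP => _; rewrite ?mulf_neq0 ?sign2_neq0.
- by rewrite !c'V ?memvD // cM.
- exact: mixed.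
- by rewrite mulrC mixed // gC (addrC y).
(* Two coset elements have their sum back in [V]; the factor [d * d] accounts for the term [g e e]
   of the shifted cocycle. *)
- rewrite !c'e // cocycle_shift addrACA Z2pow_addxx addr0 c'V ?memvD //.
  rewrite !sign2D -dd.
  have E := cM h k hV kV.
  ring: E.
Qed.

Lemma sign_cocycle_coboundary : exists c : Z2pow n -> K,
  (forall x, c x != 0) /\
  (forall x y, c x * c y = sign2 K (g x y) * c (x + y)).
Proof.
have spanc (s : seq (Z2pow n)) : exists c, trivializes c <<s>>%VS.
  elim: s => [|e s [c cV]]; last first.
    by rewrite span_cons; apply: trivializes_extend cV.
  (* On the zero subspace the constant 1 works because [g 0 0 = 0]. *)
  exists (fun=> 1); split=> [x|x y]; first exact: oner_neq0.
  rewrite span_nil !memv0 => /eqP -> _.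
  by rewrite (g0 y).1 /sign2 !mulr1.
have [c [c0 cM]] := spanc (vbasis fullv).
by exists c; split=> // x y; apply: cM; rewrite (span_basis (vbasisP _)) memvf.
Qed.

End SignCocycle.

Section Rescaling.
Variables (K : fieldType) (n : nat) (f f' : Z2pow n -> Z2pow n -> 'F_2).
Variable c : Z2pow n -> K.

Definition rescale (a : twalg K f) : twalg K f' :=
  [ffun x => c x * tw_coord a x].

Lemma rescale_is_linear : linear rescale.
Proof.
move=> k a b; apply/ffunP => x; rewrite !ffunE /tw_coord !ffunE.
by rewrite /GRing.scale /= mulrDr mulrCA.
Qed.

HB.instance Definition _ :=
  GRing.isLinear.Build K (twalg K f) (twalg K f') _ rescale rescale_is_linear.

Lemma rescale_coord a x : tw_coord (rescale a) x = c x * tw_coord a x.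
Proof. by rewrite {1}/tw_coord ffunE. Qed.

Lemma rescale_basis x : rescale (tw_basis K f x) = c x *: tw_basis K f' x.
Proof.
apply/ffunP => y; rewrite -![LHS]/(tw_coord _ y) -![RHS]/(tw_coord _ y).
rewrite rescale_coord tw_coordZ !tw_coord_basis.
by case: eqP => [->|]; rewrite ?mulr0.
Qed.

(** The product is determined by the basis, so the last hypothesis, which compares products of basis
    vectors, gives multiplicativity; dividing by [c] gives the inverse. *)
Lemma rescale_graded_isomorphic :
  (forall x, c x != 0) -> c 0 = 1 ->
  (forall x y, c x * c y * sign2 K (f' x y) = sign2 K (f x y) * c (x + y)) ->
  graded_isomorphic K f f'.
Proof.
move=> c0 c1 cM; exists rescale.
have inj : injective rescale.
  move=> a b E; apply/ffunP => x; apply: (mulfI (c0 x)).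
  by rewrite -!/(tw_coord _ x) -!rescale_coord E.
split=> /=.
- exists (fun b : twalg K f' => [ffun x => (c x)^-1 * tw_coord b x] : twalg K f).
    move=> a; apply: inj; apply/ffunP => x.
    by rewrite !ffunE {1}/tw_coord !ffunE rescale_coord mulKf.
  by move=> b; apply/ffunP => x; rewrite ffunE /tw_coord ffunE mulVKf.
- by rewrite /tw_one rescale_basis c1 scale1r.
- move=> a b; rewrite /tw_mul linear_sum; apply: eq_bigr => x _.
  rewrite linear_sum; apply: eq_bigr => y _.
  rewrite linearZ /= rescale_basis scalerA !rescale_coord; congr (_ *: _).
  have E := cM x y; ring: E.
- move=> x a; apply/vlineP/vlineP => -[k E].
    exists (k / c x); apply: inj.
    by rewrite E linearZ /= rescale_basis scalerA divfK.
  by exists (k * c x); rewrite E linearZ /= rescale_basis scalerA.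
Qed.

End Rescaling.

Theorem theorem1 (R : realType) (n : nat) (n_ge1 : (1 <= n)%N)
    (f f' : Z2pow n -> Z2pow n -> 'F_2)
    (f_norm : normalized f) (f'_norm : normalized f') :
  (exists alpha : Z2pow n -> 'F_2,
     generating_function f alpha /\ generating_function f' alpha) ->
  graded_isomorphic (complex R) f f'.
Proof.
case=> alpha [[fB fP] [f'B f'P]].
(* [tw_beta] and [tw_phi] are additive in the twist, so a common [alpha] makes both vanish on
   [g]. *)
pose g x y := f x y + f' x y.
have g0 : normalized g.
  move=> x; have [f0x fx0] := f_norm x; have [f'0x f'x0] := f'_norm x.
  by rewrite /g f0x fx0 f'0x f'x0 addr0.
have gC x y : g x y = g y x.
  have := etrans (fB x y) (esym (f'B x y)); rewrite /g /tw_beta.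
  move: (f x y) (f y x) (f' x y) (f' y x).
  by do 4! [case=> [[|[|//]] ?]] => /(congr1 val) //= _; apply/val_inj.
have gA x y z : tw_phi g x y z = 0.
  have -> : tw_phi g x y z = tw_phi f x y z + tw_phi f' x y z.
    by rewrite /tw_phi /g; ring.
  by rewrite fP f'P addr22.
have [c [c0 cM]] := sign_cocycle_coboundary (sqr_i R) g0 gC gA.
apply: (@rescale_graded_isomorphic _ _ _ _ c) => // [|x y].
  (* The product rule at [(0, 0)] reads [c 0 * c 0 = c 0], and [c 0] is nonzero. *)
  apply: (mulfI (c0 0)).
  by rewrite cM (g0 0).1 addr0 /sign2 mul1r mulr1.
by rewrite cM /g mulrAC -sign2D -addrA addr22 addr0.
Qed.
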